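(* For every integer $t \geq 3$, $$43 \cdot 3^{t-3} +1 \leq R_t(3).$$
   Context: A tournament of order $m$ is an orientation of the complete graph on $m$ vertices; it is transitive if its vertices can be listed $a_1,\dots,a_m$ with $a_i \to a_j$ for all $i<j$. The multicolor directed Ramsey number $R(n_1,n_2,\dots,n_t)$ is the smallest integer $m$ such that any tournament of order $m$ whose edges have been colored with $t$ colors contains, for some $1 \leq i \leq t$, a transitive subtournament of order $n_i$ all of whose edges have color $i$ (these numbers exist). $R_t(n)$ denotes $R(n,n,\dots,n)$ with $t$ arguments. *)

(* Defs.v *)
From mathcomp Require Import all_boot.

Set Implicit Arguments.
Unset Strict Implicit.
Unset Printing Implicit Defensive.

Definition tournament (T : finType) (e : rel T) : bool :=
  [forall x, ~~ e x x] && [forall x, forall y, (x != y) ==> (e x y (+) e y x)].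

(* The subtournament induced on S is transitive: S can be listed (without
   repetition, as the list has length #|S|) so that every earlier vertex
   dominates every later one. *)
Definition transitive_sub (T : finType) (e : rel T) (S : {set T}) : bool :=
  [exists s : #|S|.-tuple T, ([set x in s] == S) && pairwise e s].

Section Ramsey.

Variable t : nat.

(* An edge coloring assigns a color to every ordered pair; only its values on
   the arcs of e are ever used. *)
Definition monochromatic (T : finType) (e : rel T) (c : T -> T -> 'I_t)
    (i : 'I_t) (S : {set T}) : bool :=
  [forall x in S, forall y in S, e x y ==> (c x y == i)].

Definition has_mono_transitive (n : 'I_t -> nat) (T : finType)
    (e : rel T) (c : T -> T -> 'I_t) : bool :=
  [exists i : 'I_t, exists S : {set T},
    [&& #|S| == n i, transitive_sub e S & monochromatic e c i S]].

Definition arrows (n : 'I_t -> nat) (m : nat) : bool :=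
  [forall e : {ffun 'I_m -> {ffun 'I_m -> bool}},
   forall c : {ffun 'I_m -> {ffun 'I_m -> 'I_t}},
    tournament (fun x y => e x y) ==>
    has_mono_transitive n (fun x y => e x y) (fun x y => c x y)].

Lemma tournament_irr (T : finType) (e : rel T) x : tournament e -> e x x = false.
Proof. by case/andP=> /forallP/(_ x)/negbTE. Qed.

Lemma tournament_xor (T : finType) (e : rel T) x y :
  tournament e -> x != y -> e x y (+) e y x.
Proof. by case/andP=> _ /forallP/(_ x)/forallP/(_ y)/implyP. Qed.

Lemma has_mono_transitive_seq n (T : finType) (e : rel T) (c : T -> T -> 'I_t)
    i (s : seq T) :
  tournament e -> size s = n i ->
  pairwise (fun x y => e x y && (c x y == i)) s ->
  has_mono_transitive n e c.
Proof.
move=> te szs ps.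
have us : uniq s.
  rewrite uniq_pairwise; apply: sub_pairwise ps => x y /= /andP[exy _].
  by apply: contraTneq exy => ->; rewrite tournament_irr.
have cS : #|[set x in s]| = size s by rewrite cardsE; apply/card_uniqP.
apply/existsP; exists i; apply/existsP; exists [set x in s].
apply/and3P; split; first by rewrite cS szs.
  have szs' : size s == #|[set x in s]| by rewrite cS.
  apply/existsP; exists (Tuple szs'); rewrite eqxx /=.
  by apply: sub_pairwise ps => x y /= /andP[].
apply/forall_inP=> x; rewrite inE => xs; apply/forall_inP=> y; rewrite inE => ys.
apply/implyP=> exy; move: ps xs ys {szs us cS}.
elim: s => [|z s IHs] //= /andP[/allP zs ps].
rewrite !inE => /predU1P[xz | xs] /predU1P[yz | ys]; last exact: IHs.
- by move: exy; rewrite xz yz tournament_irr.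
- by subst z; case/andP: (zs _ ys).
- subst z; case/andP: (zs _ xs) => eyx _.
  have nxy : x != y by apply: contraTneq exy => ->; rewrite tournament_irr.
  by have := tournament_xor te nxy; rewrite exy eyx.
Qed.

Lemma directed_ramsey_bound s : exists N, forall (n : 'I_t -> nat),
  \sum_i n i <= s -> forall (T : finType) (e : rel T) (c : T -> T -> 'I_t),
  tournament e -> forall A : {set T}, N <= #|A| ->
  exists i, exists2 l : seq T, size l = n i /\ {subset l <= A} &
    pairwise (fun x y => e x y && (c x y == i)) l.
Proof.
elim: s => [|s [N IHN]].
  exists 1 => n sn T e c te A; rewrite card_gt0 => /set0Pn[x xA].
  exists (c x x), [::] => //; split=> //=.
  by move: sn; rewrite leqn0 sum_nat_eq0 => /forallP/(_ (c x x))/eqP.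
exists (t * N.*2).+2 => n sn T e c te A cA.
have /set0Pn[x xA] : A != set0 by rewrite -card_gt0; apply: leq_trans cA.
pose B (o : bool) i :=
  [set y in A | if o then e x y && (c x y == i) else e y x && (c y x == i)].
have [o [i NB]] : exists o i, N <= #|B o i|.
  case: (pickP (fun p : bool * 'I_t => N <= #|B p.1 p.2|)) => [[o i] | small].
    by move=> h; exists o, i.
  suff : #|A :\ x| <= t * N.*2.
    by move: cA; rewrite (cardsD1 x) xA add1n ltnS => h1 h2;
       have := leq_trans h1 h2; rewrite ltnn.
  have sub : A :\ x \subset \bigcup_(p : bool * 'I_t) B p.1 p.2.
    apply/subsetP=> y; rewrite !inE => /andP[nyx yA].
    have nxy : x != y by rewrite eq_sym.
    have := tournament_xor te nxy; case exy: (e x y) => /= eyx; apply/bigcupP.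
      by exists (true, c x y); rewrite //= inE yA exy eqxx.
    by exists (false, c y x); rewrite //= inE yA eyx eqxx.
  apply: leq_trans (subset_leq_card sub) _.
  have leU (I : finType) (F : I -> {set T}) :
    #|\bigcup_i F i| <= \sum_i #|F i|.
    elim/big_rec2: _ => [|j k S _ le]; first by rewrite cards0.
    apply: leq_trans (leq_card_setU _ _) _; exact: leq_add.
  apply: leq_trans (leU _ _) _.
  apply: (@leq_trans (\sum_(p : bool * 'I_t) N)).
    by apply: leq_sum => p _; rewrite ltnW // ltnNge small.
  by rewrite sum_nat_const card_prod card_bool card_ord -muln2 (mulnC 2) -mulnA (mulnC 2).
case ni : (n i) => [|k]; first by exists i, [::].
pose n' j := if j == i then k else n j.
have sn' : \sum_j n' j <= s.
  rewrite -ltnS; apply: leq_trans sn.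
  rewrite (bigD1 i) // [X in _ < X](bigD1 i) //= /n' eqxx ni addSn ltnS.
  by rewrite leq_add2l; apply: leq_sum => j /negbTE ->.
have [j [l [szl lB] pl]] := IHN n' sn' T e c te (B o i) NB.
have lA : {subset l <= A} by move=> y /lB; rewrite inE => /andP[].
have [ji | nji] := eqVneq j i; last first.
  by exists j, l => //; split=> //; rewrite szl /n' (negbTE nji).
subst j; rewrite /n' eqxx in szl.
case: o {NB} lB => lB.
  exists i, (x :: l).
    split; first by rewrite /= szl.
    by move=> y; rewrite inE => /predU1P[-> // | /lA].
  rewrite /= pl andbT; apply/allP=> y /lB; rewrite inE; by case/andP.
exists i, (rcons l x).
  split; first by rewrite size_rcons szl.
  by move=> y; rewrite mem_rcons inE => /predU1P[-> // | /lA].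
rewrite pairwise_rcons pl andbT; apply/allP=> y /lB; rewrite inE; by case/andP.
Qed.

Lemma arrows_exists (n : 'I_t -> nat) : exists m, arrows n m.
Proof.
have [N HN] := directed_ramsey_bound (\sum_i n i).
exists N; apply/forallP=> e; apply/forallP=> c; apply/implyP=> te.
have := HN n (leqnn _) _ _ (fun x y => c x y) te [set: 'I_N].
rewrite cardsT card_ord => /(_ (leqnn _)) [i [l [szl _] pl]].
exact: has_mono_transitive_seq szl pl.
Qed.

(* R(n_1, ..., n_t), with the arguments indexed by 'I_t. *)
Definition directed_ramsey (n : 'I_t -> nat) : nat := ex_minn (arrows_exists n).

End Ramsey.

(* R_t(n) *)
Definition diag_directed_ramsey (t n : nat) : nat :=
  directed_ramsey (fun _ : 'I_t => n).

(* Main.v *)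
Require Import Defs.
From mathcomp Require Import all_boot.
From mathcomp Require Import all_algebra.

(** A [t]-colored tournament without monochromatic transitive triangle on [m]
    vertices shows [m < R_t(3)], since the property is inherited by induced
    subtournaments.

    On 43 vertices and with 3 colors, identify the vertices with the field
    ['F_43].  The map [d |-> d ^+ 7] sends the nonzero elements onto the sixth
    roots of unity, which are the powers of [-6], and [(-6) ^+ 3 = -1].  As 7 is
    odd, [d ^+ 7] and [(- d) ^+ 7] are opposite, so exactly one of them lies in
    [{1, -6, (-6) ^+ 2}]: put an arc from [x] to [y] when [(y - x) ^+ 7] does,
    and color it by this value.
    A monochromatic transitive triangle would give
    [a] and [b] with [a ^+ 7 = b ^+ 7 = (a + b) ^+ 7 != 0]; dividing by [a], an
    element [u] with [u ^+ 7 = 1 = (1 + u) ^+ 7], and there is none: the subgroup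
    of order 7 is sum-free ([one_pow7_sum_free], checked on the 43 values of
    [u]).

    Each further color triples the number of vertices ([triple_avoids]): arrange
    three copies of the tournament in a cyclic triangle and give all arcs
    between distinct copies the new color.  The new color class maps
    homomorphically to the cyclic triangle, so it has no transitive triangle. *)

Set Implicit Arguments.
Unset Strict Implicit.
Unset Printing Implicit Defensive.

(** No transitive triangle [x -> y -> z], [x -> z] has its three arcs of the same
    color. *)
Definition avoids_triangle t (T : finType) (e : rel T) (c : T -> T -> 'I_t) :=
  forall x y z, e x y -> e y z -> e x z -> ~ (c x y = c y z /\ c x z = c y z).

Lemma avoids_not_mono t (T : finType) (e : rel T) (c : T -> T -> 'I_t) :
  avoids_triangle e c -> ~~ has_mono_transitive (fun=> 3) e c.
Proof.
move=> av; apply/negP=> /existsP[i /existsP[S /and3P[/eqP cS]]].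
case/existsP=> s /andP[/eqP sS ps] /forall_inP mono.
have [l [szl lS pl]] : exists l : seq T,
    [/\ size l = 3, l =i S & pairwise e l].
  exists s; split=> //; first by rewrite size_tuple.
  by move=> u; rewrite -[in RHS]sS inE.
case: l szl lS pl => [|x [|y [|z []]]] //= _ lS.
rewrite !andbT => /andP[/andP[xy xz] yz].
have col u v : u \in [:: x; y; z] -> v \in [:: x; y; z] -> e u v -> c u v = i.
  move=> us vs uv; have uS : u \in S by rewrite -lS.
  have vS : v \in S by rewrite -lS.
  by have /forall_inP/(_ v vS)/implyP/(_ uv)/eqP := mono u uS.
by case: (av x y z xy yz xz); rewrite !col // !inE eqxx ?orbT.
Qed.

Lemma card_lt_diag_directed_ramsey t (T : finType) (e : rel T)
    (c : T -> T -> 'I_t) :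
  tournament e -> avoids_triangle e c -> #|T| < diag_directed_ramsey t 3.
Proof.
move=> te av; rewrite /diag_directed_ramsey /directed_ramsey.
case: ex_minnP => m arr _; rewrite ltnNge; apply/negP=> le_mT.
pose f (i : 'I_m) : T := enum_val (widen_ord le_mT i).
have f_inj : injective f by move=> i j /enum_val_inj/(congr1 val) /= /val_inj.
have := arr => /forallP/(_ [ffun x => [ffun y => e (f x) (f y)]]).
move=> /forallP/(_ [ffun x => [ffun y => c (f x) (f y)]]).
apply/negP; rewrite negb_imply; apply/andP; split.
  apply/andP; split; first by apply/forallP=> x; rewrite !ffunE tournament_irr.
  apply/forallP=> x; apply/forallP=> y; apply/implyP=> nxy; rewrite !ffunE.
  by apply: tournament_xor te _; rewrite (inj_eq f_inj).
by apply: avoids_not_mono => x y z; rewrite !ffunE; apply: av.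
Qed.

Section Triple.

Variables (t : nat) (T : finType) (e : rel T) (c : T -> T -> 'I_t).

(** Three copies of [e], arranged in a cyclic triangle. *)
Definition triple_rel : rel (T * 'I_3) := fun u v =>
  if u.2 == v.2 then e u.1 v.1 else v.2 == ordS u.2.

(** The arcs inside a copy keep their color, the other ones get the new color. *)
Definition triple_color (u v : T * 'I_3) : 'I_t.+1 :=
  if u.2 == v.2 then lift ord_max (c u.1 v.1) else ord_max.

Lemma triple_tournament : tournament e -> tournament triple_rel.
Proof.
move=> te; apply/andP; split; apply/forallP=> -[x i].
  by rewrite /triple_rel /= eqxx tournament_irr.
apply/forallP=> -[y j]; apply/implyP; rewrite /triple_rel /= xpair_eqE.
rewrite (eq_sym j i); case: (eqVneq i j) => [_ | ].
  by rewrite andbT; apply: tournament_xor.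
by case: i j => [[|[|[|]]] // ?] [[|[|[|]]] // ?].
Qed.

Lemma triple_avoids : avoids_triangle e c ->
  avoids_triangle triple_rel triple_color.
Proof.
move=> av [x i] [y j] [z k]; rewrite /triple_rel /triple_color /=.
have neqM h : lift ord_max h <> ord_max :> 'I_t.+1.
  by apply/eqP; rewrite eq_sym neq_lift.
have [ij | nij] := eqVneq i j; have [ik | nik] := eqVneq i k.
- rewrite -ij -ik eqxx => xy yz xz [/lift_inj cxy /lift_inj cxz].
  exact: (av x y z).
- by rewrite -ij (negbTE nik) => _ _ _ [/neqM].
- by rewrite -ik (eq_sym j i) (negbTE nij) => _ _ _ [_ /neqM].
case: (eqVneq j k) => [_ | njk].
  by move=> _ _ _ [/esym/neqM].
(* Both [j] and [k] would be the cyclic successor of [i]. *)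
by move=> /eqP ji _ /eqP ki; case/eqP: njk; rewrite ki ji.
Qed.

End Triple.

Lemma inord_index_inj (A : eqType) n (s : seq A) (p q : A) : size s = n.+1 ->
  p \in s -> q \in s ->
  inord (index p s) = inord (index q s) :> 'I_n.+1 -> p = q.
Proof.
move=> szs ps qs /(congr1 val) /=.
by rewrite !inordK -?szs ?index_mem //; apply: index_inj.
Qed.

Section Cyclotomic.

Import GRing.Theory.
Local Open Scope ring_scope.

(** Representatives, up to sign, of the sixth roots of unity of ['F_43]. *)
Definition roots43 : seq 'F_43 := [:: 1; -6; 36].

(** [x] dominates [y] when [(y - x) ^+ 7] is in [roots43]; the position of this
    value in the list is the color of the arc. *)
Definition cyclo_rel : rel 'F_43 := fun x y => (y - x) ^+ 7 \in roots43.

Definition cyclo_color (x y : 'F_43) : 'I_3 :=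
  inord (index ((y - x) ^+ 7) roots43).

(** A boolean predicate on ['F_43] can be decided by evaluating it at the
    residues 0, ..., 42. *)
Lemma F43_forall (P : pred 'F_43) :
  all (fun n => P (inZp n)) (iota 0 43) -> forall u, P u.
Proof.
move=> /allP allP u; rewrite -[u]valZpK; apply: allP.
by rewrite mem_iota; apply: (ltn_ord u).
Qed.

Lemma one_pow7_sum_free (u : 'F_43) : u ^+ 7 = 1 -> (1 + u) ^+ 7 <> 1.
Proof.
move=> /eqP u1; apply/eqP; move: u1; apply/implyP; move: u.
by apply: F43_forall; vm_compute.
Qed.

Lemma roots43_antisym (d : 'F_43) :
  d != 0 -> (d ^+ 7 \in roots43) (+) ((- d) ^+ 7 \in roots43).
Proof. by apply/implyP; move: d; apply: F43_forall; vm_compute. Qed.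

(** Each coset of the subgroup of order 7 of the nonzero elements is sum-free. *)
Lemma sum_free_pow7 (a b : 'F_43) :
  a != 0 -> a ^+ 7 = b ^+ 7 -> (a + b) ^+ 7 <> b ^+ 7.
Proof.
move=> a0 ab sab; have a70 : a ^+ 7 != 0 by rewrite expf_neq0.
apply: (@one_pow7_sum_free (b / a)); first by rewrite expr_div_n -ab divff.
by rewrite -{1}(divff a0) -mulrDl expr_div_n sab -ab divff.
Qed.

Lemma cyclo_tournament : tournament cyclo_rel.
Proof.
apply/andP; split; apply/forallP=> x; first by rewrite /cyclo_rel subrr.
apply/forallP=> y; apply/implyP=> nxy.
by rewrite /cyclo_rel -(opprB y x) roots43_antisym // subr_eq0 eq_sym.
Qed.

Lemma cyclo_avoids : avoids_triangle cyclo_rel cyclo_color.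
Proof.
have color_inj (p q : 'F_43) : p \in roots43 -> q \in roots43 ->
    inord (index p roots43) = inord (index q roots43) :> 'I_3 -> p = q.
  exact: inord_index_inj.
move=> x y z xy yz xz [/(color_inj _ _ xy yz) cxy /(color_inj _ _ xz yz)].
rewrite -(subrKA y) addrC; apply: sum_free_pow7 cxy.
(* [0 ^+ 7 = 0] is not among [roots43], so an arc has distinct ends. *)
by apply: contraTneq xy; rewrite /cyclo_rel => ->.
Qed.

End Cyclotomic.

Lemma exists_avoiding_tournament k :
  exists (T : finType) (e : rel T) (c : T -> T -> 'I_(k + 3)),
    [/\ #|T| = 43 * 3 ^ k, tournament e & avoids_triangle e c].
Proof.
elim: k => [|k [T [e [c [cT te av]]]]].
  exists 'F_43, cyclo_rel, cyclo_color; split; last exact: cyclo_avoids.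
    by rewrite card_Fp.
  exact: cyclo_tournament.
exists (T * 'I_3)%type, (triple_rel e), (triple_color c); split.
- by rewrite card_prod card_ord cT -mulnA expnSr.
- exact: triple_tournament.
- exact: triple_avoids.
Qed.

Theorem corollary2p9 (t : nat) (ht : 3 <= t) :
  43 * 3 ^ (t - 3) + 1 <= diag_directed_ramsey t 3.
Proof.
have [T [e [c [cT te av]]]] := exists_avoiding_tournament (t - 3).
have := card_lt_diag_directed_ramsey te av.
by rewrite cT subnK // addn1.
Qed.
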